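(* Let $p\in(1,2)$, $\alpha>0$, $\widetilde\Phi(x)=\frac\alpha p\langle x\rangle^p$ and $\mathsf T=v\cdot\nabla_x-\nabla_x\widetilde\Phi\cdot\nabla_v$ on $\mathbb R^3_x\times\mathbb R^3_v$. For every $\lambda\in(1/2,1)$ and $0<\delta<\frac13-\frac1{p+2}$, there exist constants $N\ge1$ and $C_1>0$ such that, for all $x,v\in\mathbb R^3$, $$N\langle v\rangle^{-6}e^{(2\lambda-1)\widetilde\Phi+\lambda|v|^2}-\mathsf T(x\cdot v)\,e^{2(\lambda-\frac1{p+2}-\delta)(\widetilde\Phi+\frac12|v|^2)}\ \ge\ C_1e^{2(\lambda-\frac1{p+2}-\delta)(\widetilde\Phi+\frac12|v|^2)}.$$
   Context: $\langle\cdot\rangle=(1+|\cdot|^2)^{1/2}$. $\mathsf T(x\cdot v)$ is the operator $\mathsf T$ applied to the function $(x,v)\mapsto x\cdot v$. *)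

(* Defs.v *)
From mathcomp Require Import all_boot all_order all_algebra.
From mathcomp Require Import all_classical all_reals all_analysis.

Set Implicit Arguments.
Unset Strict Implicit.
Unset Printing Implicit Defensive.

Import Order.TTheory GRing.Theory Num.Theory.
Import numFieldNormedType.Exports.

Local Open Scope ring_scope.

Definition dot (R : realType) (n : nat) (x y : 'rV[R]_n) : R :=
  \sum_(i < n) x 0 i * y 0 i.

(* The Euclidean norm: the canonical norm `|x| on 'rV[R]_n is the sup norm. *)
Definition enorm (R : realType) (n : nat) (x : 'rV[R]_n) : R :=
  Num.sqrt (dot x x).

Definition bracket (R : realType) (n : nat) (x : 'rV[R]_n) : R :=
  Num.sqrt (1 + enorm x ^+ 2).

Definition grad (R : realType) (n : nat) (f : 'rV[R]_n -> R) (x : 'rV[R]_n) :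
    'rV[R]_n :=
  \row_(i < n) 'D_(delta_mx 0 i) f x.

Definition grad_x (R : realType) (n : nat) (f : 'rV[R]_n * 'rV[R]_n -> R)
    (z : 'rV[R]_n * 'rV[R]_n) : 'rV[R]_n :=
  grad (fun x => f (x, z.2)) z.1.

Definition grad_v (R : realType) (n : nat) (f : 'rV[R]_n * 'rV[R]_n -> R)
    (z : 'rV[R]_n * 'rV[R]_n) : 'rV[R]_n :=
  grad (fun v => f (z.1, v)) z.2.

Definition transport (R : realType) (n : nat) (Phi : 'rV[R]_n -> R)
    (f : 'rV[R]_n * 'rV[R]_n -> R) (z : 'rV[R]_n * 'rV[R]_n) : R :=
  dot z.2 (grad_x f z) - dot (grad Phi z.1) (grad_v f z).

Definition potential (R : realType) (n : nat) (alpha p : R) (x : 'rV[R]_n) : R :=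
  alpha / p * bracket x `^ p.

(* Main.v *)
Require Import Defs.
From mathcomp Require Import all_boot all_order all_algebra.
From mathcomp Require Import all_classical all_reals all_analysis.
From mathcomp Require Import ring lra.

Set Implicit Arguments.
Unset Strict Implicit.
Unset Printing Implicit Defensive.

Import Order.TTheory GRing.Theory Num.Theory.
Import numFieldNormedType.Exports.

Local Open Scope ring_scope.

(** After division by the exponential on the right, with b = 1/(p+2) + delta and
    a = 1 - 2b > 0, the claim for C_1 = 1 reads
      N <v>^-6 exp(b |v|^2 - a Phi) >= 1 + |v|^2 - alpha <x>^(p-2) |x|^2.
    If the right-hand side is nonpositive there is nothing to do.  Otherwise
    alpha <x>^p <= 1 + alpha + |v|^2, so the exponent is at least c |v|^2 - K with
    c = b - a/p = (p+2) delta / p > 0, and exp(c |v|^2) dominates <v>^8. *)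

Section Dot.
Context {R : realType} {n : nat}.
Implicit Types (x y v : 'rV[R]_n) (t : R).

Lemma dotC x y : dot x y = dot y x.
Proof. by apply: eq_bigr => i _; rewrite mulrC. Qed.

Lemma dotDl x y v : dot (x + y) v = dot x v + dot y v.
Proof. by rewrite -big_split; apply: eq_bigr => i _; rewrite mxE mulrDl. Qed.

Lemma dotZl t x y : dot (t *: x) y = t * dot x y.
Proof. by rewrite /dot mulr_sumr; apply: eq_bigr => i _; rewrite mxE mulrA. Qed.

Lemma dot_deltal (i : 'I_n) x : dot (delta_mx 0 i) x = x 0 i.
Proof.
rewrite /dot (bigD1 i)//= big1 ?addr0; first by rewrite mxE !eqxx mul1r.
by move=> j ji; rewrite mxE (negPf ji) andbF mul0r.
Qed.

Lemma dot_ge0 x : 0 <= dot x x.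
Proof. by apply: sumr_ge0 => i _; rewrite -expr2 sqr_ge0. Qed.

Lemma enorm_sqr x : enorm x ^+ 2 = dot x x.
Proof. by rewrite sqr_sqrtr// dot_ge0. Qed.

Lemma bracket_powR x (p : R) : bracket x `^ p = (1 + dot x x) `^ (p / 2).
Proof.
rewrite /bracket enorm_sqr -powR12_sqrt -?powRrM 1?mulrC//.
by rewrite addr_ge0// dot_ge0.
Qed.

Lemma bracket_exp6 x : bracket x ^+ 6 = (1 + dot x x) ^+ 3.
Proof.
by rewrite (exprM _ 2 3) /bracket enorm_sqr sqr_sqrtr// addr_ge0// dot_ge0.
Qed.

(** Restricting to a line turns partial derivatives into derivatives of real functions of one
    variable, which [is_derive] computes. *)
Lemma derive_line (f : 'rV[R]_n -> R) x v :
  'D_v f x = 'D_1 (fun t : R => f (t *: v + x)) 0.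
Proof.
rewrite /derive /=; set F := fun=> _; set G := fun=> _.
suff -> : F = G by [].
by apply/funext => h; rewrite /F /G /= addr0 scale0r add0r [_ *: 1]mulr1.
Qed.

Lemma grad_dotl v x : grad (fun y => dot y v) x = v.
Proof.
apply/rowP => i; rewrite mxE derive_line.
under eq_fun do rewrite dotDl dotZl dot_deltal.
apply: derive_val; apply: is_derive_eq.
by rewrite /= scaler0 add0r addr0 [_ *: _]mulr1.
Qed.

Lemma grad_dotr v x : grad (dot v) x = v.
Proof.
by rewrite -[RHS](grad_dotl v x); congr grad; apply/funext => y; rewrite dotC.
Qed.

(** Along a coordinate line through [x], the squared bracket is a quadratic polynomial [q] in [t],
    positive at 0, so the chain rule for [powR] applies there. *)
Lemma grad_potential (alpha p : R) x : p != 0 ->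
  grad (potential alpha p) x = (alpha * (1 + dot x x) `^ (p / 2 - 1)) *: x.
Proof.
move=> p0; apply/rowP => i; rewrite !mxE derive_line.
set q : R -> R := fun t => 1 + dot x x + (t * (2 * x 0 i) + t ^+ 2).
have q0 : q 0 = 1 + dot x x by rewrite /q mul0r expr0n/= !addr0.
have -> : (fun t : R => potential alpha p (t *: delta_mx 0 i + x)) =
    (alpha / p) \*: ((fun y : R => y `^ (p / 2)) \o q).
  apply/funext => t; rewrite /potential bracket_powR /=; congr (_ * _ `^ _).
  rewrite /q !(dotDl, dotZl, dot_deltal) !mxE eqxx/= dotC dotDl dotZl dot_deltal.
  rewrite eqxx mulr1n; ring.
have q_gt0 : 0 < q 0 by rewrite q0 ltr_pwDl// dot_ge0.
have dq : is_derive (0 : R) 1 q (2 * x 0 i).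
  apply: is_derive_eq; rewrite /= !(scaler0, add0r, addr0) /GRing.scale/=.
  ring.
have dp := is_derive1_powR (p / 2) q_gt0.
apply: derive_val; apply: is_derive_eq.
by rewrite q0 /GRing.scale/=; field.
Qed.

Lemma transport_dot (Phi : 'rV[R]_n -> R) x v :
  transport Phi (fun z => dot z.1 z.2) (x, v) = dot v v - dot (grad Phi x) x.
Proof. by rewrite /transport /grad_x /grad_v /= grad_dotl grad_dotr. Qed.

End Dot.

(** Write [expR (c * s)] as the fourth power of [expR (c / 4 * s)] and bound the latter below by
    [1 + c / 4 * s]. *)
Lemma expr4_le_expR (R : realType) (c s : R) : 0 < c -> 0 <= s ->
  (Num.min 1 (c / 4) * (1 + s)) ^+ 4 <= expR (c * s).
Proof.
move=> c0 s0.
have -> : c * s = 4%:R * (c / 4 * s) by field.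
rewrite expRM_natl lerXn2r ?nnegrE ?expR_ge0 ?mulr_ge0 ?le_min ?addr_ge0//.
  by rewrite ler01 divr_ge0// ltW.
apply: le_trans (expR_ge1Dx _); rewrite mulrDr mulr1 lerD// ?ge_min ?lexx//.
by rewrite ler_wpM2r// ge_min lexx orbT.
Qed.

Theorem lemma4p4 (R : realType) (p alpha : R)
    (hp1 : 1 < p) (hp2 : p < 2) (halpha : 0 < alpha)
    (lambda delta : R)
    (hlambda1 : 1 / 2 < lambda) (hlambda2 : lambda < 1)
    (hdelta1 : 0 < delta) (hdelta2 : delta < 1 / 3 - 1 / (p + 2)) :
  exists N C1 : R, [/\ 1 <= N, 0 < C1 &
    forall x v : 'rV[R]_3,
      N * bracket v ^- 6
          * expR ((2 * lambda - 1) * potential alpha p x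
                  + lambda * enorm v ^+ 2)
      - transport (potential alpha p)
          (fun z : 'rV[R]_3 * 'rV[R]_3 => dot z.1 z.2) (x, v)
          * expR (2 * (lambda - 1 / (p + 2) - delta)
                  * (potential alpha p x + 1 / 2 * enorm v ^+ 2))
      >= C1 * expR (2 * (lambda - 1 / (p + 2) - delta)
                  * (potential alpha p x + 1 / 2 * enorm v ^+ 2))].
Proof.
have p_gt0 : 0 < p by lra.
set b : R := 1 / (p + 2) + delta.
set a : R := 1 - 2 * b.
(* The upper bound on [delta] says [b < 1 / 3], whence [a > 1 / 3]. *)
have a_gt0 : 0 < a by rewrite /a /b; lra.
set c : R := (p + 2) * delta / p.
have c_gt0 : 0 < c by rewrite divr_gt0 ?mulr_gt0//; lra.
(* [1 / (p + 2)] is exactly the root of [b - (1 - 2 * b) / p], so [delta > 0] gives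
   [c > 0]. *)
have cE : c = b - a / p by rewrite /c /a /b; field; rewrite !gt_eqF//; lra.
set K : R := a * (1 + alpha) / p.
set m : R := Num.min 1 (c / 4).
have m_gt0 : 0 < m by rewrite lt_min ltr01 divr_gt0.
(* The summand 1 gives [1 <= N]; [expR K] offsets the loss [- K] in the exponent, and [m ^+ 4] is
   the constant of [expr4_le_expR]. *)
exists (1 + expR K / m ^+ 4), 1; split => //.
  by rewrite lerDl divr_ge0 ?expR_ge0 ?exprn_ge0// ltW.
move=> x v; rewrite transport_dot grad_potential ?gt_eqF// dotZl.
rewrite bracket_exp6 enorm_sqr /potential bracket_powR.
have -> : 2 * (lambda - 1 / (p + 2) - delta) = 2 * (lambda - b).
  by rewrite /b; ring.
have := dot_ge0 v; have := dot_ge0 x.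
(* Only the scalars [s] $=|v|^2$ and [r] $=|x|^2$ matter from here on; below, [q] is $\langle
   x\rangle^{p-2}$ and [P] is $\langle x\rangle^p$. *)
move: (dot v v) (dot x x) => s r r0 s0.
set q := (1 + r) `^ (p / 2 - 1).
set P := (1 + r) `^ (p / 2).
have r1_gt0 : 0 < 1 + r by rewrite ltr_pwDl.
have PE : P = q * (1 + r).
  rewrite /P /q -[X in _ = _ * X](powRr1 (ltW r1_gt0)).
  by rewrite -powRD ?subrK ?(gt_eqF r1_gt0) ?implybT.
have q_le1 : q <= 1.
  by rewrite -[leRHS](powRr0 (1 + r)) ler_powR ?lerDl//; lra.
(* Since [2 * lambda - 1 = 2 * (lambda - b) - a], the right-hand exponential factors out, and
   [lambda] disappears with it. *)
have -> : (2 * lambda - 1) * (alpha / p * P) + lambda * s =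
  (b * s - a * (alpha / p * P)) +
    2 * (lambda - b) * (alpha / p * P + 1 / 2 * s).
  by rewrite /a; field; rewrite gt_eqF.
rewrite expRD mulrA -mulrBl ler_wpM2r ?expR_ge0// lerBrDr.
have s1_gt0 : 0 < 1 + s by rewrite ltr_pwDl.
have [small|large] := leP (1 + (s - alpha * q * r)) 0.
  rewrite (le_trans small)// mulr_ge0 ?expR_ge0// divr_ge0 ?exprn_ge0 ?ltW//.
  by rewrite ltr_wpDr// divr_ge0 ?expR_ge0 ?exprn_ge0// ltW.
have le_s : 1 + (s - alpha * q * r) <= 1 + s.
  by rewrite lerD2l gerBl !mulr_ge0 ?powR_ge0// ltW.
apply: le_trans le_s _.
have exponent : c * s - K <= b * s - a * (alpha / p * P).
  (* Here [alpha * P = alpha * q + alpha * q * r]: the first term is at most [alpha] by [q_le1], the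
     second is below [1 + s] by [large]. *)
  have alphaP : alpha * P <= 1 + alpha + s.
    have : alpha * q <= alpha by rewrite ger_pMr.
    by rewrite PE; nra.
  have -> : b * s - a * (alpha / p * P) =
      c * s - K + a / p * (1 + alpha + s - alpha * P).
    by rewrite cE /K; field; rewrite gt_eqF.
  by rewrite lerDl mulr_ge0 ?subr_ge0// divr_ge0// ltW.
apply: (@le_trans _ _
  (expR K / m ^+ 4 / (1 + s) ^+ 3 * expR (c * s - K))); last first.
  apply: ler_pM; rewrite ?expR_ge0 ?ler_expR//.
    by rewrite !divr_ge0 ?expR_ge0 ?exprn_ge0// ltW.
  by rewrite ler_wpM2r ?invr_ge0 ?exprn_ge0 ?lerDr// ltW.
have -> : expR K / m ^+ 4 / (1 + s) ^+ 3 * expR (c * s - K) =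
    expR (c * s) / (m ^+ 4 * (1 + s) ^+ 3).
  by rewrite expRB; field; rewrite !gt_eqF ?expR_gt0.
(* Three factors [1 + s] come from $\langle v\rangle^6$ and one from the bound [le_s], which
   explains the fourth power. *)
rewrite ler_pdivlMr ?mulr_gt0 ?exprn_gt0//.
by apply: le_trans (expr4_le_expR c_gt0 s0); rewrite exprMn mulrCA -exprS.
Qed.
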